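(* Let $(x_k)_{k\ge0}$, $(d_k)_{k\ge0}$ be generated by Algorithm RDRSOM (defined in the context) with subspaces $\mathcal V_k\subset\mathrm T_{x_k}\mathcal M$ and regularization parameters $\gamma_k>0$. Suppose there are constants $M>0$ and $\gamma$ such that for every $k$: $\gamma\ge\gamma_k\ge M$; $M I\succeq V_k^\top\mathrm{Hess} f(x_k)[V_k\,\cdot\,]$; $\mathrm{grad} f(x_k)\in\mathcal V_k$; and $$\Big|f(\mathrm{Retr}_{x_k}(d_k))-\Big(f(x_k)+\langle d_k,\mathrm{grad} f(x_k)\rangle+\tfrac12\langle d_k,\mathrm{Hess} f(x_k)[d_k]\rangle\Big)\Big|\le\tfrac M6\|d_k\|^3.$$ Suppose moreover that the optimal value $f^*:=\inf_{x\in\mathcal M}f(x)$ satisfies $f^*>-\infty$. Then $$\min_{0\le k\le N}\|\mathrm{grad} f(x_k)\|=O(1/\sqrt N),$$ i.e. there is a constant $K_1$ independent of $N$ with $\min_{0\le k\le N}\|\mathrm{grad} f(x_k)\|\le K_1/\sqrt N$ for every $N\ge1$ (such that $x_0,\dots,x_N$ are generated). Consequently, for any tolerance $\epsilon>0$ the algorithm terminates within $O(1/\epsilon^2)$ iterations, i.e. within $K_2\epsilon^{-2}$ iterations for some constant $K_2$ independent of $\epsilon$.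
   Context: Setting: $\mathcal M$ is a Riemannian manifold embedded in a finite-dimensional Euclidean space $\mathcal E$ (with inner product $\langle\cdot,\cdot\rangle$ and norm $\|\cdot\|$, tangent spaces $\mathrm T_x\mathcal M\subset\mathcal E$ carrying the induced inner product), and $f:\mathcal M\to\mathbb R$ is sufficiently smooth. The problem is $\min\{f(x):x\in\mathcal M\}$. $\mathrm{Proj}_x:\mathcal E\to\mathrm T_x\mathcal M$ is the orthogonal projection. The Riemannian gradient is $\mathrm{grad} f(x)=\mathrm{Proj}_x\nabla f(x)\in\mathrm T_x\mathcal M$, and the Riemannian Hessian is the linear map $\mathrm{Hess} f(x):\mathrm T_x\mathcal M\to\mathrm T_x\mathcal M$, $\mathrm{Hess} f(x)[h]=\mathrm{Proj}_x(\mathrm D\,\mathrm{grad} f(x)[h])$. For each $x\in\mathcal M$, $\mathrm{Retr}_x:\mathrm T_x\mathcal M\to\mathcal M$ is a retraction: $\mathrm{Retr}_x(0)=x$ and $\mathrm D\mathrm{Retr}_x(0)$ is the identity. $V_k$ denotes a matrix whose columns form an orthonormal basis of $\mathcal V_k$, so $V_k^\top\mathrm{Hess} f(x_k)[V_k\,\cdot\,]$ is the (symmetric) matrix on $\mathbb R^{\dim\mathcal V_k}$ representing the quadratic form $d\mapsto\langle\mathrm{Hess} f(x_k)[d],d\rangle$ restricted to $\mathcal V_k$; $A\succeq B$ means $A-B$ is positive semidefinite. Algorithm RDRSOM: input $x_0\in\mathcal M$ and $\epsilon>0$; set $k=0$. While $\|\mathrm{grad} f(x_k)\|\ge\epsilon$: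 choose a linear subspace $\mathcal V_k\subset\mathrm T_{x_k}\mathcal M$ and $\gamma_k>0$; let $d_k$ be a global minimizer over $d\in\mathcal V_k$ of $$f(x_k)+\langle\mathrm{grad} f(x_k),d\rangle+\tfrac12\langle\mathrm{Hess} f(x_k)[d],d\rangle+\tfrac{\gamma_k}{6}\|d\|^3;$$ set $x_{k+1}=\mathrm{Retr}_{x_k}(d_k)$ and $k\leftarrow k+1$. *)

(* Defs.v *)
From HB Require Import structures.
From mathcomp Require Import all_boot all_order all_algebra.
From mathcomp Require Import all_classical all_reals all_analysis.

Set Implicit Arguments.
Unset Strict Implicit.
Unset Printing Implicit Defensive.

Import Order.TTheory GRing.Theory Num.Theory.
Import numFieldNormedType.Exports.

Local Open Scope classical_set_scope.
Local Open Scope ring_scope.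

(* Finite-dimensional normed spaces.  A Euclidean space is such a space with an
   inner product [ip : {dot E for idfun}].  The library norm [`|_|] of E serves
   only for its topology; it need not be the norm of [ip], but all norms of E
   are equivalent, so limits and differentials do not depend on it. *)
#[short(type="normedVectType")]
HB.structure Definition NormedVector (R : numFieldType) :=
  { E of NormedModule R E & Vector R E }.

HB.instance Definition _ (R : numFieldType) m n := Vector.on 'M[R]_(m, n).

Section Smoothness.
Context {R : realType} {V W : normedModType R}.

(* [f] is n times continuously differentiable on the open set [U]. *)
Fixpoint Ck (n : nat) (U : set V) (f : V -> W) : Prop :=
  if n is n'.+1 then
    (forall x, U x -> differentiable f x) /\ (forall v, Ck n' U ('D_v f))
  else forall x, U x -> {for x, continuous f}.

Definition smooth (U : set V) (f : V -> W) : Prop := forall n, Ck n U f.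

End Smoothness.

Section Loewner.
Context {R : realType} {n : nat}.

Definition psd (A : 'M[R]_n) : Prop :=
  forall u : 'cV[R]_n, 0 <= (u^T *m A *m u) 0 0.

Definition loewner_ge (A B : 'M[R]_n) : Prop := psd (A - B).

End Loewner.

Section Euclidean.
Context {R : realType} {E : normedVectType R} (ip : {dot E for idfun}).

Definition enorm (v : E) : R := Num.sqrt (ip v v).

Definition Proj (U : {vspace E}) : 'End(E) := daddv_pi U (orthov ip U).

Definition orthonormal_basis (U : {vspace E}) (B : seq E) : bool :=
  basis_of U B && orthonormal ip B.

(* The matrix B^T H[B .], where B has the given columns. *)
Definition compression (n : nat) (H : E -> E) (B : n.-tuple E) : 'M[R]_n :=
  \matrix_(i, j) ip (tnth B i) (H (tnth B j)).

(* Riesz representative of a linear form. *)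
Definition riesz (l : E -> R) : E := get [set g | forall v, ip g v = l v].

End Euclidean.

Section Manifold.
Context {R : realType} {E : normedVectType R} (M : set E).

(* Smooth embedded submanifold, of codimension m: around each of its points, M
   is the zero set of a smooth map to R^m with surjective differential. *)
Definition embedded_submanifold : Prop :=
  exists m : nat, forall x, M x ->
    exists (U : set E) (h : E -> 'rV[R]_m),
      [/\ open U, U x, smooth U h,
          (forall w, exists v, 'd h x v = w) &
          M `&` U = [set y | U y /\ h y = 0]].

Definition curve_velocity (x v : E) : Prop :=
  exists (c : R -> E) (I : set R),
    [/\ open I, I 0, smooth I c & forall t, I t -> M (c t)] /\
    c 0 = x /\ 'D_1 c 0 = v.

(* The set of velocities at x is a linear subspace when M is an embedded
   submanifold; [tangent x] is that set, packed as a {vspace E}. *)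
Definition tangent (x : E) : {vspace E} :=
  xget 0%VS [set T : {vspace E} | forall v, v \in T <-> curve_velocity x v].

(* A map on M is a function on E of which only the values on M matter.  Its
   differential at x is that of any local extension differentiable at x; on
   [tangent x] it does not depend on the extension. *)
Definition mdiff {W : normedModType R} (F : E -> W) (x : E) : E -> W :=
  'd (xget F [set G : E -> W |
        differentiable G x /\ \forall y \near x, M y -> G y = F y]) x.

Definition mCk {W : normedModType R} (n : nat) (F : E -> W) : Prop :=
  forall x, M x -> exists (U : set E) (G : E -> W),
    [/\ open U, U x, Ck n U G & forall y, U y -> M y -> G y = F y].

(* Retr x is meant on [tangent x].  The last clause says that its differential
   at 0 is the identity. *)
Definition retraction (Retr : E -> E -> E) : Prop :=
  forall x, M x ->
    [/\ forall v, v \in tangent x -> M (Retr x v),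
        Retr x 0 = x &
        (fun v => Retr x v - x - v)
          =o_ (within [set v | v \in tangent x] (nbhs (0 : E))) (fun v => v)].

End Manifold.

Section RDRSOM.
Context {R : realType} {E : normedVectType R} (ip : {dot E for idfun}).
Context (M : set E) (f : E -> R).

Definition grad (x : E) : E := Proj ip (tangent M x) (riesz ip (mdiff M f x)).

Definition Hess (x h : E) : E := Proj ip (tangent M x) (mdiff M grad x h).

Definition model (gam : R) (x d : E) : R :=
  f x + ip (grad x) d + 2^-1 * ip (Hess x d) d + gam / 6 * enorm ip d ^+ 3.

(* The while test succeeds at x_0, ..., x_(k-1), i.e. x_k is generated.  So
   iteration k (the one that computes d_k) is performed iff
   [generated eps x k.+1]. *)
Definition generated (eps : R) (x : nat -> E) (k : nat) : Prop :=
  forall j, (j < k)%N -> eps <= enorm ip (grad (x j)).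

(* A run is described by infinite sequences, which are constrained only as far
   as the algorithm generates them. *)
Definition rdrsom_run (Retr : E -> E -> E) (x0 : E) (eps : R)
    (V : nat -> {vspace E}) (gam : nat -> R) (x d : nat -> E) : Prop :=
  x 0%N = x0 /\
  forall k, generated eps x k.+1 ->
    [/\ (V k <= tangent M (x k))%VS,
        0 < gam k,
        d k \in V k,
        (forall e, e \in V k ->
           model (gam k) (x k) (d k) <= model (gam k) (x k) e) &
        x k.+1 = Retr (x k) (d k)].

(* The assumptions on iteration k: [B] is an orthonormal basis of V_k. *)
Definition step_assumptions (Retr : E -> E -> E) (Mc gmax : R)
    (V : {vspace E}) (B : (\dim V).-tuple E) (gam : R) (x d : E) : Prop :=
  [/\ Mc <= gam <= gmax,
      orthonormal_basis ip V B,
      loewner_ge Mc%:M (compression ip (Hess x) B),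
      grad x \in V &
      `| f (Retr x d)
         - (f x + ip d (grad x) + 2^-1 * ip d (Hess x d)) |
        <= Mc / 6 * enorm ip d ^+ 3].

End RDRSOM.

(* Main.v *)
Require Import Defs.
From HB Require Import structures.
From mathcomp Require Import all_boot all_order all_algebra.
From mathcomp Require Import all_classical all_reals all_analysis.
From mathcomp Require Import ring lra.

Set Implicit Arguments.
Unset Strict Implicit.
Unset Printing Implicit Defensive.

Import Order.TTheory GRing.Theory Num.Theory.
Import numFieldNormedType.Exports.

Local Open Scope classical_set_scope.
Local Open Scope ring_scope.

(** Write G(y) for the norm of the Riemannian gradient at y.  Since the cubic
    weight gam_k is at least Mc, the Taylor bound makes the regularized model an
    upper bound for f at the new iterate.  The model is minimized over a subspace
    that contains the gradient, so its minimal value is at most its value at a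
    step of any length s along the negative gradient, where the Loewner bound
    controls the quadratic term ([step_descent]):

      f (x_{k+1}) <= f (x_k) - s G(x_k) + Mc s^2 / 2 + gmax s^3 / 6.

    Let m be a lower bound of G over the iterates considered.  Taking s = a m
    rather than s = a G(x_k) makes the linear term at least a m^2 and leaves the
    cubic term, of order m^3, to be dominated.  That requires an upper bound A on
    m, and m <= G(x_0) =: A comes for free because x_0 is among the iterates.
    With a small enough in terms
    of Mc, gmax and A, each step lowers f by at least a m^2 / 3
    ([step_const_decrease]).

    Summing over N steps ([run_descent]) gives N m^2 <= D / c with c = a / 3 and
    D = f(x_0) - inf f.  The choice of m as the smallest gradient norm gives the
    rate 1 / sqrt N; the choice m = eps bounds the number of iterations before
    termination.  The constants depend on x_0, Mc, gmax and inf f only. *)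

(** * Inner products and curvature on a subspace *)

Section InnerProduct.
Context {R : realType} {E : normedVectType R} (ip : {dot E for idfun}).

Lemma dotC u v : ip u v = ip v u.
Proof. by rewrite hermC /= expr0 mul1r. Qed.

Lemma dotZr a u v : ip u (a *: v) = a * ip u v.
Proof. by rewrite linearZr_LR. Qed.

Lemma dotZl a u v : ip (a *: u) v = a * ip u v.
Proof. by rewrite linearZl_LR. Qed.

Lemma dot_ge0 u : 0 <= ip u u.
Proof.
have [->|u0] := eqVneq u 0; first by rewrite linear0r.
exact/ltW/neq0_dnorm_gt0.
Qed.

Lemma enorm_ge0 u : 0 <= enorm ip u.
Proof. exact: sqrtr_ge0. Qed.

Lemma enorm_sqr u : enorm ip u ^+ 2 = ip u u.
Proof. by rewrite sqr_sqrtr ?dot_ge0. Qed.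

Lemma enormZ a u : enorm ip (a *: u) = `|a| * enorm ip u.
Proof.
by rewrite /enorm dotZl dotZr mulrA -expr2 sqrtrM ?sqr_ge0// sqrtr_sqr.
Qed.

Lemma orthonormal_dot n (B : n.-tuple E) (i j : 'I_n) :
  orthonormal ip B -> ip (tnth B i) (tnth B j) = (i == j)%:R.
Proof.
move=> /andP[/allP B1 B2].
have diag k : ip (tnth B k) (tnth B k) = 1.
  by apply/eqP/(B1 (tnth B k)); rewrite mem_tnth.
have ortho (s : seq E) (k l : nat) : pair_ortho_rec ip s ->
    (k < l < size s)%N -> ip s`_k s`_l = 0.
  elim: s k l => [|w s IH] k l; first by rewrite ltn0 andbF.
  move=> /andP[/andP[/allP ow _] os].
  case: l => [|l]; first by rewrite ltn0.
  case: k => [|k]; rewrite /= ltnS => kl; last by apply: IH.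
  by apply/eqP/ow; rewrite mem_nth.
have lt_ortho (k l : 'I_n) : (k < l)%N -> ip (tnth B k) (tnth B l) = 0.
  move=> kl; rewrite !(tnth_nth 0); apply: ortho => //.
  by rewrite kl size_tuple ltn_ord.
case: (ltngtP i j) => [ij|ji|/val_inj ->]; last by rewrite eqxx.
- by rewrite lt_ortho// (negbTE (_ : i != j))// -val_eqE /= ltn_eqF.
- by rewrite dotC lt_ortho// (negbTE (_ : i != j))// -val_eqE /= gtn_eqF.
Qed.

(** In the coordinates of an orthonormal basis, the compression represents the
    quadratic form of [H] and the identity matrix represents the squared norm,
    so the Loewner inequality can be tested on coordinate vectors. *)
Lemma loewner_quadratic_le (V : {vspace E}) (B : (\dim V).-tuple E)
    (H : {linear E -> E}) (c : R) :
  orthonormal_basis ip V B -> loewner_ge c%:M (compression ip H B) ->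
  {in V, forall v, ip (H v) v <= c * ip v v}.
Proof.
move=> /andP[basB onB] cH v vV.
pose u : 'cV[R]_(\dim V) := \col_i coord B i v.
have vE : v = \sum_i u i 0 *: tnth B i.
  rewrite {1}(coord_basis basB vV); apply: eq_bigr => i _.
  by rewrite mxE (tnth_nth 0).
have quad (L : {linear E -> E}) :
    (u^T *m compression ip L B *m u) 0 0 = ip v (L v).
  rewrite [X in L X]vE linear_sum linear_sumr mxE; apply: eq_bigr => j _.
  rewrite linearZ_LR /= dotZr mulrC; congr (_ * _).
  rewrite vE linear_sumlz mxE; apply: eq_bigr => i _.
  by rewrite /= dotZl !mxE.
(* Seeing the identity matrix as a compression too lets [quad] evaluate both
   sides of the Loewner inequality. *)
have cE : c%:M = c *: compression ip (idfun : {linear E -> E}) B.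
  apply/matrixP => i j; rewrite !mxE /= orthonormal_dot//.
  by rewrite mulr_natr.
have := cH u; rewrite cE mulmxBr mulmxBl -scalemxAr -scalemxAl.
rewrite mxE [X in _ + X]mxE [X in X + _]mxE !quad subr_ge0 /=.
by rewrite [ip (H v) v]dotC.
Qed.
End InnerProduct.

(** * Decrease of the objective in one iteration *)

Section Model.
Context {R : realType} {E : normedVectType R} (ip : {dot E for idfun}).
Context (M : set E) (f : E -> R).

Lemma Hess_is_linear (x : E) : linear (Hess ip M f x).
Proof. by move=> a u v; rewrite /Hess /mdiff !linearP. Qed.

HB.instance Definition _ (x : E) :=
  GRing.isLinear.Build R E E *:%R (Hess ip M f x) (Hess_is_linear x).

Local Notation G x := (enorm ip (grad ip M f x)).

(** Only the curvature in the direction of the gradient enters the value of the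
    model along the negative gradient; [s] is the length of the step. *)
Lemma model_steepest_descent (gam c s : R) (x : E) :
  0 <= s -> 0 < G x ->
  ip (Hess ip M f x (grad ip M f x)) (grad ip M f x) <= c * G x ^+ 2 ->
  model ip M f gam x (- (s / G x) *: grad ip M f x) <=
    f x - s * G x + c / 2 * s ^+ 2 + gam / 6 * s ^+ 3.
Proof.
move=> s0 G0 curv; have t0 : 0 <= s / G x by rewrite divr_ge0 ?enorm_ge0.
rewrite /model enormZ normrN ger0_norm//.
rewrite divfK ?gt_eqF// dotZr -enorm_sqr dotZr [Hess _ _ _ _ _]linearZ_LR /=.
rewrite dotZl lerD2r.
have -> : - (s / G x) * G x ^+ 2 = - (s * G x) by field; rewrite gt_eqF.
have := ler_wpM2l (sqr_ge0 (s / G x)) curv.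
have -> : (s / G x) ^+ 2 * (c * G x ^+ 2) = c * s ^+ 2.
  by field; rewrite gt_eqF.
move: (s / G x) (ip (Hess _ _ _ _ _) _) => t q tq; lra.
Qed.

(** The Taylor bound has cubic weight [c / 6] and the model has weight
    [gam / 6 >= c / 6], so the model at its minimizer [d] dominates [f (Retr x d)]; the
    minimizer is then compared with a gradient step of length [s]. *)
Lemma step_descent (Retr : E -> E -> E) (c gmax : R) (V : {vspace E})
    (B : (\dim V).-tuple E) (gam s : R) (x d : E) :
  step_assumptions ip M f Retr c gmax B gam x d ->
  (forall e, e \in V -> model ip M f gam x d <= model ip M f gam x e) ->
  0 <= s -> 0 < G x ->
  f (Retr x d) <= f x - s * G x + c / 2 * s ^+ 2 + gmax / 6 * s ^+ 3.
Proof.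
move=> [/andP[cgam gamgmax] onB psdB gV /ler_normlW taylor] dmin s0 G0.
have curv := loewner_quadratic_le onB psdB gV.
rewrite -enorm_sqr in curv.
have := le_trans (dmin _ (memvZ _ gV)) (model_steepest_descent gam s0 G0 curv).
have d3 : c / 6 * enorm ip d ^+ 3 <= gam / 6 * enorm ip d ^+ 3.
  by rewrite ler_wpM2r ?exprn_ge0 ?enorm_ge0// ler_wpM2r.
have s3 : gam / 6 * s ^+ 3 <= gmax / 6 * s ^+ 3.
  by rewrite ler_wpM2r ?exprn_ge0// ler_wpM2r.
rewrite /model (dotC ip _ d) (dotC ip _ d) => descent.
lra.
Qed.

(** Ratio of the length of the comparison step to the lower bound m on the
    gradient norm.  The three summands keep [a * c], [a * (`|gmax| * A)] and [a]
    at most 1 for a = [step_const c gmax A]; the absolute value keeps [a] positive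
    when no iteration takes place, in which case nothing forces gmax > 0. *)
Definition step_const (c gmax A : R) : R := (c + `|gmax| * A + 1)^-1.

Lemma step_const_gt0 (c gmax A : R) : 0 < c -> 0 <= A ->
  0 < step_const c gmax A.
Proof.
by move=> c0 A0; rewrite invr_gt0 ltr_wpDl// addr_ge0 ?mulr_ge0// ltW.
Qed.

(** Measured in units of a m^2, the linear term gains at least 1 while the
    quadratic and cubic terms lose at most 1/2 and 1/6, which leaves 1/3. *)
Lemma step_const_decrease (c gmax A m g : R) :
  0 < c -> 0 <= m -> m <= A -> m <= g ->
  - (step_const c gmax A * m * g) + c / 2 * (step_const c gmax A * m) ^+ 2
    + gmax / 6 * (step_const c gmax A * m) ^+ 3
  <= - (step_const c gmax A / 3 * m ^+ 2).
Proof.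
move=> c0 m0 mA mg; set a := step_const _ _ _; set s := a * m.
have A0 : 0 <= A := le_trans m0 mA.
have a0 : 0 < a := step_const_gt0 gmax c0 A0.
have aE : a * c + a * (`|gmax| * A) + a = 1.
  rewrite -[X in _ + X]mulr1 -!mulrDr mulVf// gt_eqF//.
  by rewrite -invr_gt0; exact: a0.
have gA0 : 0 <= a * (`|gmax| * A) by rewrite !mulr_ge0 ?(ltW a0).
have ac : a * c <= 1 by lra.
have ac0 : 0 <= a * c by rewrite ltW ?mulr_gt0.
have a1 : a <= 1 by lra.
have gm : gmax * m <= `|gmax| * A.
  apply: (@le_trans _ _ (`|gmax| * m)); first by rewrite ler_wpM2r ?ler_norm.
  by rewrite ler_wpM2l.
have cubic : a ^+ 2 * (gmax * m) <= 1.
  apply: (@le_trans _ _ (a * (a * (`|gmax| * A)))).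
    by rewrite [leRHS]mulrA -expr2 ler_wpM2l ?sqr_ge0.
  by rewrite mulr_ile1 ?(ltW a0)//; lra.
have p0 : 0 <= a * m ^+ 2 by rewrite mulr_ge0 ?sqr_ge0 ?(ltW a0).
have lin : a * m ^+ 2 <= s * g.
  by rewrite /s -mulrA expr2 !ler_wpM2l// ltW.
have quad : c * s ^+ 2 <= a * m ^+ 2.
  have -> : c * s ^+ 2 = (a * c) * (a * m ^+ 2) by rewrite /s; ring.
  by rewrite ler_piMl.
have cub : gmax * s ^+ 3 <= a * m ^+ 2.
  have -> : gmax * s ^+ 3 = (a ^+ 2 * (gmax * m)) * (a * m ^+ 2).
    by rewrite /s; ring.
  by rewrite ler_piMl.
lra.
Qed.

(** * Complexity of the algorithm *)

Context (Retr : E -> E -> E) (x0 : E) (c gmax : R).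
Context (eps : R) (V : nat -> {vspace E}) (gam : nat -> R) (x d : nat -> E).
Context (B : forall k, (\dim (V k)).-tuple E).

(** The conclusion [M (x N)], carried along the induction, lets the lower bound
    of [f] on [M] be applied to the last iterate. *)
Lemma run_descent (A m : R) (N : nat) :
  retraction M Retr -> M x0 -> 0 < c -> 0 < eps ->
  rdrsom_run ip M f Retr x0 eps V gam x d ->
  (forall k, generated ip M f eps x k.+1 ->
     step_assumptions ip M f Retr c gmax (B k) (gam k) (x k) (d k)) ->
  generated ip M f eps x N ->
  0 <= m -> m <= A -> (forall k, (k < N)%N -> m <= G (x k)) ->
  M (x N) /\ f (x N) + N%:R * (step_const c gmax A / 3 * m ^+ 2) <= f x0.
Proof.
move=> HR Mx0 c0 eps0 [x0E run] steps + m0 mA.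
elim: N => [|N IH] gen mG; first by rewrite x0E mul0r addr0.
have [|k kN|MxN fN] := IH.
- by move=> k kN; apply: gen; rewrite ltnW.
- by apply: mG; rewrite ltnW.
have [VT gam0 dV dmin ->] := run N gen.
have [Retr_in _ _] := HR _ MxN.
split; first exact/Retr_in/(subvP VT).
have A0 : 0 <= A := le_trans m0 mA.
have s0 : 0 <= step_const c gmax A * m.
  by rewrite mulr_ge0// ltW// step_const_gt0.
have GN0 : 0 < G (x N) := lt_le_trans eps0 (gen N (ltnSn N)).
have := step_descent (steps N gen) dmin s0 GN0.
have := step_const_decrease gmax c0 m0 mA (mG N (ltnSn N)).
rewrite -[N.+1%:R]natr1 mulrDl mul1r => decr stepN.
lra.
Qed.

End Model.

Theorem theorem2p5 (R : realType) (E : normedVectType R)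
    (ip : {dot E for idfun}) (M : set E) (f : E -> R) (Retr : E -> E -> E)
    (x0 : E) (Mc gmax : R) :
  embedded_submanifold M ->
  mCk M 2 f ->
  retraction M Retr ->
  M x0 ->
  0 < Mc ->
  (-oo < ereal_inf [set (f y)%:E | y in M])%E ->
  exists K1 K2 : R,
    forall (eps : R) (V : nat -> {vspace E}) (gam : nat -> R) (x d : nat -> E)
           (B : forall k, (\dim (V k)).-tuple E),
      0 < eps ->
      rdrsom_run ip M f Retr x0 eps V gam x d ->
      (forall k, generated ip M f eps x k.+1 ->
         step_assumptions ip M f Retr Mc gmax (B k) (gam k) (x k) (d k)) ->
      (forall N, (1 <= N)%N -> generated ip M f eps x N ->
         \big[Num.min/enorm ip (grad ip M f (x 0%N))]_(0 <= k < N.+1)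
            enorm ip (grad ip M f (x k)) <= K1 / Num.sqrt N%:R) /\
      (exists k, [/\ generated ip M f eps x k,
                     enorm ip (grad ip M f (x k)) < eps &
                     k%:R <= K2 / eps ^+ 2]).
Proof.
move=> _ _ HR Mx0 Mc0 inf_gtNy.
pose G y := enorm ip (grad ip M f y).
(* The infimum itself is a real lower bound: it is not +oo as M contains x0. *)
have [flb flbP] : exists flb : R, forall y, M y -> flb <= f y.
  move: inf_gtNy.
  case infE : (ereal_inf _) => [r| |] // _.
    exists r => y My; rewrite -lee_fin -infE.
    by apply: ereal_inf_lbound; exists y.
  have : (ereal_inf [set (f y)%:E | y in M] <= (f x0)%:E)%E.
    by apply: ereal_inf_lbound; exists x0.
  by rewrite infE leye_eq.
pose c := step_const Mc gmax (G x0) / 3.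
have c0 : 0 < c by rewrite divr_gt0// step_const_gt0// enorm_ge0.
pose D := f x0 - flb.
exists (Num.sqrt (D / c)), (D / c) => eps V gam x d B eps0 run steps.
have x0E : x 0%N = x0 by case: run.
have budget N m : generated ip M f eps x N -> 0 <= m -> m <= G x0 ->
    (forall k, (k < N)%N -> m <= G (x k)) -> N%:R * m ^+ 2 <= D / c.
  move=> gen m0 mG0 mG.
  have [MxN] := run_descent HR Mx0 Mc0 eps0 run steps gen m0 mG0 mG.
  have := flbP _ MxN; rewrite -/c ler_pdivlMr// /D; lra.
have D0 : 0 <= D / c by rewrite divr_ge0 ?subr_ge0 ?flbP// ltW.
split=> [N N1 gen|].
  set m := \big[Num.min/_]_(_ <= k < _) _.
  have N0 : 0 < N%:R :> R by rewrite ltr0n.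
  rewrite ler_pdivlMr ?sqrtr_gt0//.
  (* The range of the minimum includes k = 0, hence m <= G x0 as [budget] asks. *)
  have [m0|m0] := lerP 0 m; last first.
    by apply: (@le_trans _ _ 0); rewrite ?sqrtr_ge0// mulr_le0_ge0 ?sqrtr_ge0 ?ltW.
  have mG k : (k < N.+1)%N -> m <= G (x k).
    move=> kN; rewrite /m big_mkord.
    exact: (@bigmin_le _ _ _ _ (Ordinal kN)).
  rewrite -(ler_sqr _ _) ?nnegrE ?mulr_ge0 ?sqrtr_ge0//.
  rewrite exprMn !sqr_sqrtr ?ler0n// mulrC budget//.
    by rewrite -x0E mG.
  by move=> k kN; apply: mG; rewrite ltnW.
have eps_le N : generated ip M f eps x N -> N%:R <= D / c / eps ^+ 2.
  rewrite ler_pdivlMr ?exprn_gt0//.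
  case: N => [|N] gen; first by rewrite mul0r.
  (* eps <= G x0 holds because the first iteration was performed. *)
  by apply: budget => //; [exact: ltW|rewrite -x0E; exact: gen].
have stops : exists k, enorm ip (grad ip M f (x k)) < eps.
  apply: contrapT => /forallNP big.
  have gen N : generated ip M f eps x N.
    by move=> k _; rewrite leNgt; apply/negP.
  have := eps_le _ (gen (Num.bound (D / c / eps ^+ 2))).
  apply/negP; rewrite -ltNge.
  by apply: archi_boundP; rewrite divr_ge0// exprn_ge0// ltW.
case: (ex_minnP stops) => k Gk kmin.
have gen : generated ip M f eps x k.
  move=> j jk; rewrite leNgt; apply/negP => /kmin.
  by rewrite leqNgt jk.
by exists k; split => //; exact: eps_le.
Qed.
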